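(* Let $k$ be a field of characteristic $2$, let $n=2m$ be a positive even integer, and let $L$ be either of the Lie algebras $N_1(n,k)$ or $N_2(n,k)$. Then $L$ is absolutely simple.
   Context: A Lie algebra $L$ over $k$ is simple if its only ideals are $0$ and $L$, and absolutely simple if $L\otimes_k K$ is a simple Lie algebra over $K$ for every field extension $K/k$. Let $\alpha_1,\dots,\alpha_n$ be the standard basis of $\mathrm{GF}(2)^n$, let $(\cdot,\cdot)$ be the standard inner product $(\alpha,\beta)=\sum_i a_ib_i\in\mathrm{GF}(2)$ for $\alpha=\sum a_i\alpha_i$, $\beta=\sum b_i\alpha_i$, and put $|\alpha|=\sum_i a_i\in\mathrm{GF}(2)$. Let $\Phi=\mathrm{GF}(2)^n\setminus\{\underline 0\}$. Each of $N_1(n,k)$ and $N_2(n,k)$ is the $(2^n-1)$-dimensional $k$-vector space with basis $\{e_\alpha:\alpha\in\Phi\}$ and with the bilinear, symmetric (equivalently antisymmetric, as the characteristic is $2$) bracket with $[e_\alpha,e_\alpha]=0$ and, for $\alpha\neq\beta$ in $\Phi$, as follows. $N_1(n,k)$: (1) if $|\alpha|=|\beta|=1$, then $[e_\alpha,e_\beta]=e_{\alpha+\beta}$; (2) if $|\alpha|=0$ or $|\beta|=0$, then $[e_\alpha,e_\beta]=e_{\alpha+\beta}$ if $(\alpha,\beta)=1$ and $[e_\alpha,e_\beta]=0$ otherwise. $N_2(n,k)$: (1) if $(\alpha,\alpha_n)=0$ and $|\alpha|=|\beta|=1$, then $[e_\alpha,e_\beta]=e_{\alpha+\beta}$; (2)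 if $(\alpha,\alpha_n)=0$ and ($|\alpha|=0$ or $|\beta|=0$), then $[e_\alpha,e_\beta]=e_{\alpha+\beta}$ if $(\alpha,\beta)=1$ and $[e_\alpha,e_\beta]=0$ otherwise; (3) if $(\alpha,\alpha_n)=(\beta,\alpha_n)=1$, then $[e_\alpha,e_\beta]=0$ if $|\alpha|=|\beta|=1$ and $[e_\alpha,e_\beta]=e_{\alpha+\beta}$ otherwise. (Cases (1) and (2) are extended by symmetry in $\alpha,\beta$.) These brackets make $N_1(n,k)$ and $N_2(n,k)$ Lie algebras over $k$. *)

(* Defs.v *)
From HB Require Import structures.
From mathcomp Require Import all_boot all_order all_algebra.

Set Implicit Arguments.
Unset Strict Implicit.
Unset Printing Implicit Defensive.

Import GRing.Theory.
Local Open Scope ring_scope.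

HB.mixin Record isLieAlgebra (k : fieldType) L of GRing.Lmodule k L := {
  lie : L -> L -> L;
  lie_linearl : forall y : L, linear (lie^~ y);
  lie_linearr : forall x : L, linear (lie x);
  liexx : forall x : L, lie x x = 0;
  lie_jacobi : forall x y z : L,
    lie x (lie y z) + lie y (lie z x) + lie z (lie x y) = 0
}.

#[short(type="lieAlgType")]
HB.structure Definition LieAlgebra (k : fieldType) :=
  { L of isLieAlgebra k L & GRing.Lmodule k L }.

#[short(type="finLieAlgType")]
HB.structure Definition FinLieAlgebra (k : fieldType) :=
  { L of LieAlgebra k L & Vector k L }.

Definition lie_ideal (k : fieldType) (L : finLieAlgType k) (I : {vspace L}) :=
  forall x y : L, y \in I -> lie x y \in I.

Definition lie_simple (k : fieldType) (L : finLieAlgType k) :=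
  forall I : {vspace L}, lie_ideal I -> I = 0%VS \/ I = fullv.

(* Lie axioms need only be checked on a spanning family. *)
Section Spanning.
Variables (k : fieldType) (V : lmodType k) (f : V -> V -> V).
Variables (I : finType) (b : I -> V) (c : V -> I -> k).
Hypothesis span : forall x, x = \sum_i c x i *: b i.
Hypothesis fl : forall y, linear (f^~ y).
Hypothesis fr : forall x, linear (f x).

Let fDl x y z : f (x + y) z = f x z + f y z.
Proof. by have := fl z 1 x y; rewrite /= !scale1r. Qed.
Let fDr x y z : f x (y + z) = f x y + f x z.
Proof. by have := fr x 1 y z; rewrite /= !scale1r. Qed.
Let f0l z : f 0 z = 0.
Proof. by apply: (addrI (f 0 z)); rewrite -fDl !addr0. Qed.
Let f0r z : f z 0 = 0.
Proof. by apply: (addrI (f z 0)); rewrite -fDr !addr0. Qed.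
Let fZl a x z : f (a *: x) z = a *: f x z.
Proof. by have := fl z a x 0; rewrite /= f0l !addr0. Qed.
Let fZr a x z : f z (a *: x) = a *: f z x.
Proof. by have := fr z a x 0; rewrite /= f0r !addr0. Qed.
Let f_suml (J : Type) (r : seq J) (P : pred J) (F : J -> V) z :
  f (\sum_(i <- r | P i) F i) z = \sum_(i <- r | P i) f (F i) z.
Proof. exact: (big_morph (f^~ z) (fun x y => fDl x y z) (f0l z)). Qed.
Let f_sumr (J : Type) (r : seq J) (P : pred J) (F : J -> V) z :
  f z (\sum_(i <- r | P i) F i) = \sum_(i <- r | P i) f z (F i).
Proof. exact: (big_morph (f z) (fDr z) (f0r z)). Qed.

Lemma alternating_of_span :
  (forall i, f (b i) (b i) = 0) ->
  (forall i j, f (b i) (b j) + f (b j) (b i) = 0) ->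
  forall x, f x x = 0.
Proof.
move=> fbb fbC x; rewrite (span x); set d := c x.
elim: (index_enum I) => [|i r IH]; first by rewrite big_nil f0l.
rewrite !big_cons fDl !fDr IH addr0 fZl fZr fbb !scaler0 add0r.
rewrite f_sumr f_suml -big_split big1 // => j _ /=.
by rewrite !fZl !fZr !scalerA mulrC -scalerDr fbC scaler0.
Qed.

Let jac x y z := f x (f y z) + f y (f z x) + f z (f x y).
Let jacC x y z : jac x y z = jac y z x.
Proof. by rewrite /jac [RHS]addrC addrA. Qed.
Let jac_comb x y z : (forall i, jac (b i) y z = 0) -> jac x y z = 0.
Proof.
move=> h; rewrite (span x) /jac f_suml !(f_suml, f_sumr) -!big_split big1 // => i _.
by rewrite /= !(fZl, fZr) -!scalerDr -/(jac _ _ _) h scaler0.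
Qed.

Lemma jacobi_of_span :
  (forall i j l, f (b i) (f (b j) (b l)) + f (b j) (f (b l) (b i))
                 + f (b l) (f (b i) (b j)) = 0) ->
  forall x y z, f x (f y z) + f y (f z x) + f z (f x y) = 0.
Proof.
move=> h x y z; rewrite -/(jac x y z); apply: jac_comb => i; rewrite jacC.
apply: jac_comb => j; rewrite jacC.
by apply: jac_comb => l; rewrite jacC; apply: h.
Qed.
End Spanning.

Lemma lie_anti (k : fieldType) (L : lieAlgType k) (x y : L) :
  lie x y + lie y x = 0.
Proof.
have Dl (u v w : L) : lie (u + v) w = lie u w + lie v w.
  by have := lie_linearl w 1 u v; rewrite /= !scale1r.
have Dr (u v w : L) : lie w (u + v) = lie w u + lie w v.
  by have := lie_linearr w 1 u v; rewrite /= !scale1r.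
by have := liexx (x + y); rewrite Dl !Dr !liexx add0r addr0.
Qed.

(* L (x)_k K for a field extension iota : k -> K, realised as the K-space of
   coordinate vectors in the basis e_i (x) 1, where e = vbasis {:L}; the
   bracket is the K-bilinear one with the structure constants of L.  The
   lemmas tens_lie and tens_universal show that it does not depend on the
   choice of basis. *)
Definition lie_ext (k K : fieldType) (iota : {rmorphism k -> K})
  (L : finLieAlgType k) : Type := 'rV[K]_(\dim {:L}).

(* v |-> v (x) 1 *)
Definition tens (k K : fieldType) (iota : {rmorphism k -> K})
    (L : finLieAlgType k) (v : L) : lie_ext iota L :=
  \row_(i < \dim {:L}) iota (coord (vbasis {:L}) i v).

Section Extension.
Variables (k K : fieldType) (iota : {rmorphism k -> K}) (L : finLieAlgType k).
Let e := vbasis {:L}.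
Local Notation E := (lie_ext iota L).
Local Notation t := (@tens k K iota L).

HB.instance Definition _ := Vector.copy E 'rV[K]_(\dim {:L}).

Definition ext_lie (x y : E) : E :=
  \sum_(i < \dim {:L}) \sum_(j < \dim {:L})
    ((x : 'rV_(\dim {:L})) 0 i * (y : 'rV_(\dim {:L})) 0 j) *: t (lie e`_i e`_j).

Lemma ext_lie_linearl (y : E) : linear (ext_lie^~ y).
Proof.
move=> a u v; rewrite /ext_lie scaler_sumr -big_split /=; apply: eq_bigr => i _.
rewrite scaler_sumr -big_split /=; apply: eq_bigr => j _.
by rewrite !mxE scalerA -scalerDl mulrDl mulrA.
Qed.

Lemma ext_lie_linearr (x : E) : linear (ext_lie x).
Proof.
move=> a u v; rewrite /ext_lie scaler_sumr -big_split /=; apply: eq_bigr => i _.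
rewrite scaler_sumr -big_split /=; apply: eq_bigr => j _.
by rewrite !mxE scalerA -scalerDl mulrDr mulrCA.
Qed.

Lemma tens_is_linear : linear_for (iota \; *:%R) t.
Proof.
move=> a u v; apply/rowP=> i; rewrite !mxE /=.
by rewrite linearP /= rmorphD rmorphM.
Qed.

HB.instance Definition _ :=
  GRing.isLinear.Build k L E (iota \; *:%R) t tens_is_linear.

Lemma tens_basis (i : 'I_(\dim {:L})) : t e`_i = delta_mx 0 i.
Proof.
apply/rowP=> j; rewrite !mxE eqxx /=.
by rewrite coord_free ?(basis_free (vbasisP _)) // rmorph_nat eq_sym.
Qed.

Lemma ext_span (x : E) :
  x = \sum_(i < \dim {:L}) (x : 'rV_(\dim {:L})) 0 i *: t e`_i.
Proof.
by rewrite [LHS]row_sum_delta; apply: eq_bigr => i _; rewrite tens_basis.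
Qed.

Lemma tens_lie (u v : L) : ext_lie (t u) (t v) = t (lie u v).
Proof.
have sp w : w = \sum_(i < \dim {:L}) coord e i w *: e`_i.
  by rewrite -coord_vbasis ?memvf.
rewrite /ext_lie.
pose ll y : {linear L -> L} :=
  HB.pack (fun x : L => lie x y) (GRing.isLinear.Build _ _ _ _ _ (lie_linearl y)).
pose lr x : {linear L -> L} :=
  HB.pack (lie x) (GRing.isLinear.Build _ _ _ _ _ (lie_linearr x)).
rewrite [in RHS](sp u) -[lie _ v]/(ll v _) linear_sum raddf_sum /=.
apply: eq_bigr => i _.
have tZ a w : t (a *: w) = iota a *: t w by rewrite linearZ.
rewrite -[lie _ v]/(ll v _) linearZ tZ /= [in RHS](sp v).
rewrite -[lie _ (\sum__ _)]/(lr _ _) linear_sum raddf_sum scaler_sumr /=.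
apply: eq_bigr => j _; rewrite -[lie _ (_ *: _)]/(lr _ _) linearZ tZ scalerA.
by rewrite !mxE.
Qed.

Lemma ext_liexx (x : E) : ext_lie x x = 0.
Proof.
apply: (alternating_of_span ext_span ext_lie_linearl ext_lie_linearr).
  by move=> i; rewrite tens_lie liexx raddf0.
by move=> i j; rewrite !tens_lie -raddfD lie_anti raddf0.
Qed.

Lemma ext_jacobi (x y z : E) :
  ext_lie x (ext_lie y z) + ext_lie y (ext_lie z x) + ext_lie z (ext_lie x y)
  = 0.
Proof.
apply: (jacobi_of_span ext_span ext_lie_linearl ext_lie_linearr) => i j l.
by rewrite !tens_lie -!raddfD lie_jacobi raddf0.
Qed.

HB.instance Definition _ := isLieAlgebra.Build K E
  ext_lie_linearl ext_lie_linearr ext_liexx ext_jacobi.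

Lemma tens_universal (W : lmodType K) (f : {linear L -> W | (iota \; *:%R)}) :
  exists2 g : {linear E -> W}, forall v, g (t v) = f v &
    forall h : {linear E -> W}, (forall v, h (t v) = f v) -> h =1 g.
Proof.
pose g0 (x : E) : W := \sum_(i < \dim {:L}) (x : 'rV_(\dim {:L})) 0 i *: f e`_i.
have g0l : linear g0.
  move=> a u v; rewrite /g0 scaler_sumr -big_split /=; apply: eq_bigr => i _.
  by rewrite !mxE scalerA -scalerDl.
pose g : {linear E -> W} := HB.pack g0 (GRing.isLinear.Build _ _ _ _ _ g0l).
exists g => [v|h hf x].
  rewrite [in RHS](coord_vbasis (memvf v)) raddf_sum; apply: eq_bigr => i _.
  by rewrite /= [RHS]linearZ /= mxE.
rewrite (ext_span x) [LHS]raddf_sum [RHS]raddf_sum; apply: eq_bigr => i _.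
rewrite [LHS]linearZ [RHS]linearZ hf; congr (_ *: _).
rewrite /= /g0 (bigD1 i) //= tens_basis mxE !eqxx scale1r big1 ?addr0 // => j ji.
by rewrite mxE (negbTE ji) andbF scale0r.
Qed.
End Extension.

Definition absolutely_simple (k : fieldType) (L : finLieAlgType k) :=
  forall (K : fieldType) (iota : {rmorphism k -> K}),
    lie_simple (lie_ext iota L).

Definition Phi (n : nat) : finType := {a : 'rV['F_2]_n | a != 0}.

Definition inner (n : nat) (a b : 'rV['F_2]_n) : 'F_2 := \sum_i a 0 i * b 0 i.

Definition weight (n : nat) (a : 'rV['F_2]_n) : 'F_2 := \sum_i a 0 i.

(* alpha_n, whose only nonzero coordinate has index n - 1 *)
Definition alpha_last (n : nat) : 'rV['F_2]_n := \row_i (i.+1 == n)%:R.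

(* For a != b, N1_rel a b says that [e_a, e_b] is e_(a + b) rather than 0;
   likewise for N2_rel. *)
Definition N1_rel (n : nat) (a b : 'rV['F_2]_n) : bool :=
  if (weight a == 1) && (weight b == 1) then true else inner a b == 1.

Definition N2_rel (n : nat) (a b : 'rV['F_2]_n) : bool :=
  if (inner a (alpha_last n) == 1) && (inner b (alpha_last n) == 1) then
    ~~ ((weight a == 1) && (weight b == 1))
  else if (weight a == 1) && (weight b == 1) then true
  else inner a b == 1.

(* The basis vector e_a; it is 0 for a = 0. *)
Definition Nbasis (k : fieldType) (n : nat) (a : 'rV['F_2]_n) :
  {ffun Phi n -> k^o} := [ffun c : Phi n => (val c == a)%:R].

Definition Nbasis_lie (k : fieldType) (n : nat) (r : rel 'rV['F_2]_n)
    (a b : Phi n) : {ffun Phi n -> k^o} :=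
  if (a != b) && r (val a) (val b) then Nbasis k (val a + val b) else 0.

Definition Nlie (k : fieldType) (n : nat) (r : rel 'rV['F_2]_n)
    (x y : {ffun Phi n -> k^o}) : {ffun Phi n -> k^o} :=
  \sum_(a : Phi n) \sum_(b : Phi n) (x a * y b : k) *: Nbasis_lie k r a b.

Section NLie.
Variables (k : fieldType) (n : nat) (r : rel 'rV['F_2]_n).
Local Notation V := {ffun Phi n -> k^o}.
Local Notation br := (@Nlie k n r).
Local Notation eb := (@Nbasis k n).

Lemma Nlie_linearl (y : V) : linear (br^~ y).
Proof.
move=> a u v; rewrite /Nlie scaler_sumr -big_split /=; apply: eq_bigr => i _.
rewrite scaler_sumr -big_split /=; apply: eq_bigr => j _.
by rewrite !ffunE scalerA -scalerDl mulrDl mulrA.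
Qed.

Lemma Nlie_linearr (x : V) : linear (br x).
Proof.
move=> a u v; rewrite /Nlie scaler_sumr -big_split /=; apply: eq_bigr => i _.
rewrite scaler_sumr -big_split /=; apply: eq_bigr => j _.
by rewrite !ffunE scalerA -scalerDl mulrDr mulrCA.
Qed.

Lemma Nbasis_span (x : V) : x = \sum_a (x a : k) *: eb (val a).
Proof.
apply/ffunP=> c; rewrite sum_ffunE (bigD1 c) //= !ffunE eqxx.
rewrite [_ *: _]mulr1 big1 ?addr0 // => a ac; rewrite !ffunE.
by rewrite (inj_eq val_inj) eq_sym (negbTE ac) scaler0.
Qed.

Lemma NlieE (a b : Phi n) : br (eb (val a)) (eb (val b)) = Nbasis_lie k r a b.
Proof.
rewrite /Nlie (bigD1 a) //= (bigD1 b) //= !ffunE !eqxx mulr1 scale1r.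
rewrite !big1 ?addr0 // => [c ca|c cb].
  by rewrite big1 // => d _; rewrite !ffunE (inj_eq val_inj) (negbTE ca) mul0r scale0r.
by rewrite !ffunE !(inj_eq val_inj) (negbTE cb) mulr0 scale0r.
Qed.

Lemma Nbasis0 : eb 0 = 0.
Proof. by apply/ffunP=> c; rewrite !ffunE (negbTE (valP c)). Qed.

Hypothesis char2 : 2%N \in [pchar k].
Hypothesis rC : symmetric r.
Hypothesis r0 : forall b, r 0 b = false.
Hypothesis r_jac : forall a b c,
  (r b c && r a (b + c)) (+) (r c a && r b (c + a)) (+) (r a b && r c (a + b))
  = false.

Let addvv (v : V) : v + v = 0.
Proof. by rewrite -mulr2n -scaler_nat (pcharf0 char2) scale0r. Qed.

Let addaa (a : 'rV['F_2]_n) : a + a = 0.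
Proof. by rewrite -mulr2n -scaler_nat (_ : 2%:R = 0) ?scale0r //; apply/eqP. Qed.

Lemma Nlie_alt (x : V) : br x x = 0.
Proof.
apply: (alternating_of_span Nbasis_span Nlie_linearl Nlie_linearr).
  by move=> a; rewrite NlieE /Nbasis_lie eqxx.
move=> a b; rewrite !NlieE /Nbasis_lie eq_sym rC [val b + _]addrC.
by rewrite addvv.
Qed.

Let lie_eb a b : br (eb a) (eb b) = ((a != b) && r a b)%:R *: eb (a + b).
Proof.
have br0l y : br 0 y = 0.
  by rewrite /Nlie big1 // => i _; rewrite big1 // => j _; rewrite ffunE mul0r scale0r.
have br0r y : br y 0 = 0.
  by rewrite /Nlie big1 // => i _; rewrite big1 // => j _; rewrite ffunE mulr0 scale0r.
have [->|a0] := eqVneq a 0; first by rewrite Nbasis0 br0l r0 andbF scale0r.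
have [->|b0] := eqVneq b 0; first by rewrite Nbasis0 br0r rC r0 andbF scale0r.
have := NlieE (Sub a a0) (Sub b b0); rewrite !SubK => ->.
by rewrite /Nbasis_lie -(inj_eq val_inj) !SubK; case: ifP => _; rewrite ?scale1r ?scale0r.
Qed.

Let lie_eb' a b : br (eb a) (eb b) = (r a b)%:R *: eb (a + b).
Proof.
rewrite lie_eb; have [->|//] := eqVneq a b.
by rewrite addaa Nbasis0 !scaler0.
Qed.

Lemma Nlie_jacobi (x y z : V) :
  br x (br y z) + br y (br z x) + br z (br x y) = 0.
Proof.
apply: (jacobi_of_span Nbasis_span Nlie_linearl Nlie_linearr) => i j l.
set a := val i; set b := val j; set c := val l.
have brZ d s v : br v (s *: eb d) = s *: br v (eb d).
  pose f : {linear V -> V} :=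
    HB.pack (br v) (GRing.isLinear.Build _ _ _ _ _ (Nlie_linearr v)).
  by rewrite -[LHS]/(f _) linearZ.
rewrite !lie_eb' !brZ !lie_eb' !scalerA.
have -> : eb (b + (c + a)) = eb (a + (b + c)) by rewrite addrA addrC.
have -> : eb (c + (a + b)) = eb (a + (b + c)) by rewrite addrC -addrA.
rewrite -!scalerDl -!natrM -!natrD !mulnb.
suff -> : ((r b c && r a (b + c)) + (r c a && r b (c + a))
          + (r a b && r c (a + b)))%:R = 0 :> k by rewrite scale0r.
have two : 2%:R = 0 :> k := pcharf0 char2.
have := r_jac a b c.
case: (r b c && _); case: (r c a && _); case: (r a b && _) => //= _.
Qed.
End NLie.

(* The hypothesis char2 is an argument of the carriers because the brackets
   are alternating only in characteristic 2. *)
Definition N1 (k : fieldType) (char2 : 2%N \in [pchar k]) (n : nat) : Type :=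
  {ffun Phi n -> k^o}.

Definition N2 (k : fieldType) (char2 : 2%N \in [pchar k]) (n : nat) : Type :=
  {ffun Phi n -> k^o}.

Lemma F2D1 (a b : 'F_2) : (a + b == 1) = (a == 1) (+) (b == 1).
Proof. by case: a b => [[|[|//]]] i [[|[|//]]] j. Qed.

Section Relations.
Variable n : nat.
Implicit Types a b c : 'rV['F_2]_n.

Lemma innerC a b : inner a b = inner b a.
Proof. by apply: eq_bigr => i _; rewrite mulrC. Qed.

Lemma innerDl a b c : inner (a + b) c = inner a c + inner b c.
Proof. by rewrite -big_split; apply: eq_bigr => i _; rewrite mxE mulrDl. Qed.

Lemma innerDr a b c : inner c (a + b) = inner c a + inner c b.
Proof. by rewrite !(innerC c) innerDl. Qed.

Lemma inner0 a : inner 0 a = 0.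
Proof. by apply: big1 => i _; rewrite mxE mul0r. Qed.

Lemma weightD a b : weight (a + b) = weight a + weight b.
Proof. by rewrite -big_split; apply: eq_bigr => i _; rewrite mxE. Qed.

Lemma weight0 : weight (0 : 'rV_n) = 0.
Proof. by apply: big1 => i _; rewrite mxE. Qed.

Lemma N1_relC : symmetric (@N1_rel n).
Proof. by move=> a b; rewrite /N1_rel innerC andbC. Qed.

Lemma N2_relC : symmetric (@N2_rel n).
Proof.
move=> a b; rewrite /N2_rel [inner b a]innerC (andbC (weight b == 1)).
by rewrite (andbC (inner b _ == 1)).
Qed.

Lemma N1_rel0 b : N1_rel 0 b = false.
Proof. by rewrite /N1_rel weight0 inner0. Qed.

Lemma N2_rel0 b : N2_rel 0 b = false.
Proof. by rewrite /N2_rel weight0 !inner0. Qed.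

Lemma N1_rel_jac a b c :
  (N1_rel b c && N1_rel a (b + c)) (+) (N1_rel c a && N1_rel b (c + a))
  (+) (N1_rel a b && N1_rel c (a + b)) = false.
Proof.
rewrite /N1_rel !(weightD, innerDl, innerDr) !F2D1.
rewrite [inner b a]innerC [inner c b]innerC [inner c a]innerC.
by do 3!case: (weight _ == 1); do 3!case: (inner _ _ == 1).
Qed.

Lemma N2_rel_jac a b c :
  (N2_rel b c && N2_rel a (b + c)) (+) (N2_rel c a && N2_rel b (c + a))
  (+) (N2_rel a b && N2_rel c (a + b)) = false.
Proof.
rewrite /N2_rel; set u := alpha_last n.
rewrite !(weightD, innerDl, innerDr) !F2D1.
rewrite [inner b a]innerC [inner c b]innerC [inner c a]innerC.
by do 3!case: (weight _ == 1); do 6!case: (inner _ _ == 1).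
Qed.
End Relations.

Section Instances.
Variables (k : fieldType) (char2 : 2%N \in [pchar k]) (n : nat).

HB.instance Definition _ := Vector.copy (N1 char2 n) {ffun Phi n -> k^o}.
HB.instance Definition _ := isLieAlgebra.Build k (N1 char2 n)
  (@Nlie_linearl k n (@N1_rel n)) (@Nlie_linearr k n (@N1_rel n))
  (Nlie_alt char2 (@N1_relC n))
  (Nlie_jacobi char2 (@N1_relC n) (@N1_rel0 n) (@N1_rel_jac n)).

HB.instance Definition _ := Vector.copy (N2 char2 n) {ffun Phi n -> k^o}.
HB.instance Definition _ := isLieAlgebra.Build k (N2 char2 n)
  (@Nlie_linearl k n (@N2_rel n)) (@Nlie_linearr k n (@N2_rel n))
  (Nlie_alt char2 (@N2_relC n))
  (Nlie_jacobi char2 (@N2_relC n) (@N2_rel0 n) (@N2_rel_jac n)).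
End Instances.

(* Main.v *)
Require Import Defs.
From HB Require Import structures.
From mathcomp Require Import all_boot all_order all_algebra.

(** Both algebras have a basis indexed by the nonzero vectors of GF(2)^n, with
    [e_a, e_b] = r(a, b) e_(a + b) for a relation r, so everything reduces to
    combinatorics of r.

    An ideal is a span of basis vectors.  As 2a = 0, the square of ad e_a maps
    e_b to q_a(b) e_b with q_a(b) = r(a, b) r(a, a + b): it is diagonal with
    eigenvalues 0 and 1.  An ideal is stable under these operators, and if the
    functions q_a separate the indices, then a product of operators (ad e_a)^2
    and 1 - (ad e_a)^2 isolates any single basis vector occurring in an element
    of the ideal.  An ideal containing e_b contains e_c whenever r(b + c, b)
    holds, so it is everything once the graph with these edges is strongly
    connected ([graded_simple]).  Both conditions speak only of r, and tensoring
    with an extension field keeps the structure constants ([graded_tens]);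
    simplicity is therefore automatically absolute.

    Separation ([quad_separates]): if |a| = 0, then q_a(b) = (a, b) for both
    algebras.  These functions separate all pairs except b, b + 1, where
    1 = (1, ..., 1).  If |a| = 1 and the last coordinate of a is 0, then
    q_a(b) = (a, b) + |b|, and this separates b from b + 1 because (a, 1) = 1
    and, n being even, |1| = 0.

    Connectedness ([N1_connected], [N2_connected]): every vertex reaches the
    first standard basis vector in a few steps and is reached from it.  For n
    even, a vector of odd weight has both a coordinate 0 and a coordinate 1,
    which supplies the intermediate vertices. *)

Set Implicit Arguments.
Unset Strict Implicit.
Unset Printing Implicit Defensive.

Import GRing.Theory.
Local Open Scope ring_scope.

(** * Lie algebras graded by an elementary abelian 2-group *)

Section Graded.
Variables (V : finZmodType) (r : rel V).
Hypothesis addVV : forall a : V, a + a = 0.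

(** A spanning family suffices: no independence of the e_a is required, which
    makes the notion evidently stable under extension of scalars.  Setting
    e_0 = 0 makes the bracket formula uniform on V. *)
Definition graded (k : fieldType) (L : finLieAlgType k) (e : V -> L) :=
  [/\ forall a b, lie (e a) (e b) = (r a b)%:R *: e (a + b),
      e 0 = 0 & (\sum_a <[e a]>)%VS = fullv].

(** The eigenvalue of (ad e_a)^2 on e_b. *)
Definition quad (a b : V) : bool := r a b && r a (a + b).

Definition separating :=
  forall b c, b != 0 -> c != 0 -> b != c -> exists a, quad a b != quad a c.

(** An edge from b to c means that ad e_(b + c) maps e_b to e_c. *)
Definition edge : rel V := [rel b c | (c != 0) && r (b + c) b].

Definition connected := forall b c, b != 0 -> c != 0 -> connect edge b c.

Section Simple.
Variables (k : fieldType) (L : finLieAlgType k) (e : V -> L).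
Hypothesis gr : graded e.

Let ad (x : L) : {linear L -> L} :=
  HB.pack (lie x) (GRing.isLinear.Build _ _ _ _ _ (lie_linearr x)).

Lemma lie_sqr_diag a b v :
  v \in <[e b]>%VS -> lie (e a) (lie (e a) v) = (quad a b)%:R *: v.
Proof.
have [lie_e _ _] := gr; case/vlineP=> s ->.
have lieZ (x w : L) t : lie x (t *: w) = t *: lie x w by exact: (linearZZ (ad x)).
rewrite !(lieZ, lie_e) addrA addVV add0r !scalerA /quad -mulnb natrM.
by congr (_ *: _); rewrite -mulrA mulrC.
Qed.

(** One factor of the projection onto the line of e_b: depending on whether
    quad a b is 1 or 0, the operator is (ad e_a)^2 or its complement. *)
Lemma ideal_filter (I : {vspace L}) a b (v : V -> L) :
  lie_ideal I -> (forall d, v d \in <[e d]>%VS) -> \sum_d v d \in I ->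
  \sum_d (quad a d == quad a b)%:R *: v d \in I.
Proof.
move=> idI ve xI.
have yI : lie (e a) (lie (e a) (\sum_d v d)) \in I by apply/idI/idI.
have yE : lie (e a) (lie (e a) (\sum_d v d)) = \sum_d (quad a d)%:R *: v d.
  have lie_sum (x : L) (F : V -> L) : lie x (\sum_d F d) = \sum_d lie x (F d).
    exact: (linear_sum (ad x)).
  by rewrite !lie_sum; apply: eq_bigr => d _; apply: lie_sqr_diag.
rewrite yE in yI; case: (quad a b).
  by under eq_bigr => d _ do rewrite eqb_id.
have -> : \sum_d (quad a d == false)%:R *: v d
          = \sum_d v d - \sum_d (quad a d)%:R *: v d.
  rewrite -sumrB; apply: eq_bigr => d _.
  by case: (quad a d); rewrite ?scale1r ?scale0r ?subrr ?subr0.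
by rewrite memvB.
Qed.

Lemma ideal_isolate (I : {vspace L}) b (v : V -> L) (s : seq V) :
  separating -> lie_ideal I -> (forall d, v d \in <[e d]>%VS) ->
  \sum_d v d \in I -> b != 0 ->
  exists w : V -> L, [/\ forall d, w d \in <[e d]>%VS, \sum_d w d \in I,
    w b = v b & forall d, d \in s -> d != b -> w d = 0].
Proof.
move=> sep idI ve xI b0; have [_ e0 _] := gr.
elim: s => [|c s [w [we wI wb ws]]]; first by exists v.
have keep : w c = 0 \/ c = b -> exists w : V -> L,
    [/\ forall d, w d \in <[e d]>%VS, \sum_d w d \in I, w b = v b &
        forall d, d \in c :: s -> d != b -> w d = 0].
  move=> wc; exists w; split=> // d; rewrite inE => /orP[/eqP-> cb|]; last exact: ws.
  by case: wc cb => // ->; rewrite eqxx.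
have [cb|cb] := eqVneq c b; first by apply: keep; right.
have [c0|c0] := eqVneq c 0.
  by apply: keep; left; have := we c; rewrite c0 e0 => /vlineP[z ->]; rewrite scaler0.
have [a qa] := sep c b c0 b0 cb.
exists (fun d => (quad a d == quad a b)%:R *: w d); split.
- by move=> d; rewrite memvZ.
- exact: ideal_filter.
- by rewrite eqxx scale1r.
move=> d; rewrite inE => /orP[/eqP-> _|ds db].
  by rewrite (negbTE qa) scale0r.
by rewrite ws // scaler0.
Qed.

Lemma ideal_connect (I : {vspace L}) b c :
  lie_ideal I -> connect edge b c -> e b \in I -> e c \in I.
Proof.
have [lie_e _ _] := gr => idI /connectP[p + ->] {c}.
elim: p b => //= c p IH b /andP[/andP[_ rbc] pc] eb; apply: (IH c pc).
have := idI (e (b + c)) _ eb.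
by rewrite lie_e rbc scale1r addrAC addVV add0r.
Qed.

Theorem graded_simple : separating -> connected -> lie_simple L.
Proof.
move=> sep conn I idI; have [_ e0 span] := gr.
have [->|In0] := eqVneq I 0%VS; [by left | right].
have xI := memv_pick I.
have : vpick I \in (\sum_a <[e a]>)%VS by rewrite span memvf.
case/memv_sumP=> v ve xE; rewrite xE in xI.
have {}ve d : v d \in <[e d]>%VS by apply: ve.
have [b vb] : exists b, v b != 0.
  apply/existsP; apply: contraNT In0 => /existsPn v0.
  rewrite -vpick0 xE big1 // => d _; apply/eqP; have := v0 d.
  by rewrite negbK.
have b0 : b != 0.
  apply: contraNneq vb => b0; have := ve b.
  by rewrite b0 e0 => /vlineP[z ->]; rewrite scaler0.
have [w [we wI wb w0]] := ideal_isolate (enum V) sep idI ve xI b0.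
have ebI : e b \in I.
  move: wI; rewrite (bigD1 b) //= big1 ?addr0 => [|d db]; last first.
    by rewrite w0 ?mem_enum.
  rewrite wb; case/vlineP: (ve b) vb => z ->.
  by rewrite scaler_eq0 negb_or => /andP[z0 _] zI; rewrite -[e b](scalerK z0) memvZ.
apply/eqP; rewrite eqEsubv subvf -span; apply/subv_sumP=> c _.
rewrite -memvE; have [->|c0] := eqVneq c 0; first by rewrite e0 mem0v.
exact: ideal_connect (conn _ _ b0 c0) ebI.
Qed.
End Simple.

Lemma graded_tens (k K : fieldType) (iota : {rmorphism k -> K})
    (L : finLieAlgType k) (e : V -> L) :
  graded e -> graded (fun a => tens iota (e a)).
Proof.
case=> lie_e e0 span.
have tZ a (w : L) : tens iota (a *: w) = iota a *: tens iota w.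
  by rewrite linearZ.
split=> [a b||].
- by rewrite -[lie _ _]/(ext_lie _ _) tens_lie lie_e tZ rmorph_nat.
- by rewrite e0 raddf0.
apply/eqP; rewrite eqEsubv subvf; apply/subvP=> x _.
rewrite (ext_span x); apply: memv_suml => i _; apply: memvZ.
move: (_`_i) => w; have : w \in (\sum_a <[e a]>)%VS by rewrite span memvf.
case/memv_sumP=> v ve ->; rewrite raddf_sum; apply: memv_suml => a _.
case/vlineP: (ve a isT) => s -> /=; rewrite tZ; apply: memvZ.
by apply: (subvP (sumv_sup a isT (subvv _))); apply: memv_line.
Qed.

Corollary graded_absolutely_simple (k : fieldType) (L : finLieAlgType k)
    (e : V -> L) :
  graded e -> separating -> connected -> absolutely_simple L.
Proof.
by move=> gr sep conn K iota; apply: (graded_simple (graded_tens iota gr)).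
Qed.
End Graded.

(** * The two algebras are graded *)

Lemma addF2vv n (a : 'rV['F_2]_n) : a + a = 0.
Proof. by rewrite -mulr2n -scaler_nat (_ : 2%:R = 0) ?scale0r //; apply/eqP. Qed.

Lemma Nlie_Nbasis (k : fieldType) n (r : rel 'rV['F_2]_n) a b :
  symmetric r -> (forall c, r 0 c = false) ->
  Nlie r (Nbasis k a) (Nbasis k b) = (r a b)%:R *: Nbasis k (a + b).
Proof.
move=> rC r0.
have lin0 (f : {ffun Phi n -> k^o} -> {ffun Phi n -> k^o}) : linear f -> f 0 = 0.
  by move=> fl; apply: (addrI (f 0)); have := fl 1 0 0; rewrite !scale1r !addr0.
have [->|a0] := eqVneq a 0.
  by rewrite Nbasis0 (lin0 _ (Nlie_linearl r _)) r0 scale0r.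
have [->|b0] := eqVneq b 0.
  by rewrite Nbasis0 (lin0 _ (Nlie_linearr r _)) rC r0 scale0r.
have := NlieE k r (Sub a a0) (Sub b b0); rewrite !SubK => ->.
rewrite /Nbasis_lie -(inj_eq val_inj) !SubK.
(* For a = b the formula holds because the basis vector of a + a = 0 is 0. *)
have [->|_] := eqVneq a b; first by rewrite addF2vv Nbasis0 scaler0.
by case: (r a b); rewrite ?scale1r ?scale0r.
Qed.

Lemma Nbasis_full (k : fieldType) n :
  (\sum_a <[Nbasis k a]>)%VS = fullv :> {vspace {ffun Phi n -> k^o}}.
Proof.
apply/eqP; rewrite eqEsubv subvf; apply/subvP=> x _.
rewrite (Nbasis_span x); apply: memv_suml => a _; apply: memvZ.
by apply: (subvP (sumv_sup (val a) isT (subvv _))); apply: memv_line.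
Qed.

Lemma N1_graded (k : fieldType) (char2 : 2%N \in [pchar k]) n :
  graded (@N1_rel n) (fun a => Nbasis k a : N1 char2 n).
Proof.
split=> [a b||]; [exact: Nlie_Nbasis (@N1_relC n) (@N1_rel0 n) | |].
- exact: Nbasis0.
- exact: Nbasis_full.
Qed.

Lemma N2_graded (k : fieldType) (char2 : 2%N \in [pchar k]) n :
  graded (@N2_rel n) (fun a => Nbasis k a : N2 char2 n).
Proof.
split=> [a b||]; [exact: Nlie_Nbasis (@N2_relC n) (@N2_rel0 n) | |].
- exact: Nbasis0.
- exact: Nbasis_full.
Qed.

(** * Vectors over GF(2) *)

Lemma F2_neq1 (x : 'F_2) : (x != 1) = (x == 0).
Proof. by case: x => [[|[|//]]] i. Qed.

Section Vectors.
Variable n : nat.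
Implicit Types (a b c d : 'rV['F_2]_n) (i j : 'I_n).
Local Notation alpha i := (delta_mx 0 i : 'rV['F_2]_n).

Lemma inner_diag a : inner a a = weight a.
Proof.
by apply: eq_bigr => i _; case: (a 0 i) => [[|[|//]]] ?; apply/val_inj.
Qed.

Lemma inner_alpha i a : inner (alpha i) a = a 0 i.
Proof.
rewrite /inner (bigD1 i) //= big1 => [|j ji].
  by rewrite !mxE !eqxx mul1r addr0.
by rewrite mxE (negbTE ji) mul0r.
Qed.

Lemma inner_ones a : inner a (const_mx 1) = weight a.
Proof. by apply: eq_bigr => i _; rewrite mxE mulr1. Qed.

Lemma weight_alpha i : weight (alpha i) = 1.
Proof. by rewrite -inner_ones inner_alpha mxE. Qed.

Lemma weight_ones : ~~ odd n -> weight (const_mx 1 : 'rV['F_2]_n) = 0.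
Proof.
move=> n_even; rewrite /weight.
under eq_bigr => i _ do rewrite mxE.
rewrite sumr_const card_ord -(odd_double_half n) (negbTE n_even) -muln2 mulrnA.
by case: (1 *+ _) => [[|[|//]]] i; apply/val_inj.
Qed.

Lemma exists_coord1 a : a != 0 -> exists i, a 0 i = 1.
Proof.
move=> a0; suff /existsP[i /eqP] : [exists i, a 0 i == 1] by exists i.
apply: contraNT a0 => /existsPn h; apply/eqP/rowP => i; rewrite mxE.
by apply/eqP; rewrite -F2_neq1.
Qed.

Lemma exists_coord0 a : a != const_mx 1 -> exists i, a 0 i = 0.
Proof.
move=> a1; suff /existsP[i /eqP] : [exists i, a 0 i == 0] by exists i.
apply: contraNT a1 => /existsPn h; apply/eqP/rowP => i; rewrite mxE.
by apply/eqP; have := h i; rewrite -F2_neq1 negbK.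
Qed.

(** The orthogonal of the even vectors consists of 0 and the all-one vector:
    a vector with coordinates d_i = 1 and d_j = 0 pairs nontrivially with
    alpha_i + alpha_j. *)
Lemma exists_even_nonorthogonal d :
  d != 0 -> d != const_mx 1 -> exists2 a, weight a = 0 & inner a d = 1.
Proof.
move=> /exists_coord1[i di] /exists_coord0[j dj].
exists (alpha i + alpha j); first by rewrite weightD !weight_alpha; apply/val_inj.
by rewrite innerDl !inner_alpha di dj addr0.
Qed.

Lemma odd_neq_ones d : ~~ odd n -> weight d = 1 -> d != const_mx 1.
Proof. by move=> n_even; apply: contra_eq_neq => ->; rewrite weight_ones. Qed.

Lemma weight1_neq0 d : weight d = 1 -> d != 0.
Proof. by apply: contra_eq_neq => ->; rewrite weight0. Qed.

Lemma inner1_neq0 a d : inner a d = 1 -> a != 0.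
Proof. by apply: contra_eq_neq => ->; rewrite inner0. Qed.

(** * Separation *)

(** The even a separate all pairs but b, b + 1; an odd one splits these. *)
Lemma quad_separates (r : rel 'rV['F_2]_n) a0 :
  ~~ odd n ->
  (forall a b, weight a = 0 -> quad r a b = (inner a b == 1)) ->
  weight a0 = 1 ->
  (forall b, quad r a0 b = (inner a0 b == 1) (+) (weight b == 1)) ->
  separating r.
Proof.
move=> n_even q_even wa0 q_odd b c _ _ bc.
have bc0 : b + c != 0.
  by apply: contraNneq bc => h; rewrite -(addr0 b) -(addF2vv c) addrA h add0r.
have [bc1|bc1] := eqVneq (b + c) (const_mx 1).
  exists a0; have -> : c = b + const_mx 1 by rewrite -bc1 addrA addF2vv add0r.
  rewrite !q_odd innerDr weightD inner_ones weight_ones // wa0 addr0 F2D1.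
  by case: (_ == 1); case: (_ == 1).
have [a wa abc] := exists_even_nonorthogonal bc0 bc1.
exists a; rewrite !q_even //; move/eqP: abc; rewrite innerDr F2D1.
by case: (_ == 1); case: (_ == 1).
Qed.

(** In these four computations (a, a + b) = |a| + (a, b).  For a even, this makes
    the two factors of quad a b equal unless one of them is 1 outright; for a
    odd, exactly one of b and a + b is odd, so one factor is always 1. *)
Lemma N1_quad_even a b : weight a = 0 -> quad (@N1_rel n) a b = (inner a b == 1).
Proof.
by move=> wa; rewrite /quad /N1_rel wa /= innerDr inner_diag wa add0r andbb.
Qed.

Lemma N1_quad_odd a b : weight a = 1 ->
  quad (@N1_rel n) a b = (inner a b == 1) (+) (weight b == 1).
Proof.
move=> wa; rewrite /quad /N1_rel weightD innerDr inner_diag wa !F2D1 eqxx /=.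
by case: (_ == 1); case: (_ == 1).
Qed.

Lemma N2_quad_even a b : weight a = 0 -> quad (@N2_rel n) a b = (inner a b == 1).
Proof.
move=> wa; rewrite /quad /N2_rel wa /= innerDl innerDr inner_diag wa add0r !F2D1.
by do 2!case: (inner _ (alpha_last n) == 1); case: (inner a b == 1).
Qed.

Lemma N2_quad_odd a b : weight a = 1 -> inner a (alpha_last n) = 0 ->
  quad (@N2_rel n) a b = (inner a b == 1) (+) (weight b == 1).
Proof.
move=> wa pa; rewrite /quad /N2_rel pa /=.
rewrite weightD innerDr inner_diag wa !F2D1 eqxx /=.
by case: (_ == 1); case: (_ == 1).
Qed.

(** * Edges of the two graphs *)

Lemma N1_edge b c : edge (@N1_rel n) b c =
  (c != 0) && (if (weight b == 1) && (weight c != 1) then true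
               else (weight b == 1) (+) (inner b c == 1)).
Proof.
rewrite /edge /= /N1_rel weightD innerDl inner_diag (innerC c) !F2D1.
by case: (_ == 1); case: (_ == 1); case: (_ == 1).
Qed.

Lemma N2_edge b c : edge (@N2_rel n) b c =
  (c != 0) &&
  (if (inner b (alpha_last n) == 1) && (inner c (alpha_last n) != 1) then
     ~~ ((weight b == 1) && (weight c != 1))
   else if (weight b == 1) && (weight c != 1) then true
   else (weight b == 1) (+) (inner b c == 1)).
Proof.
rewrite /edge /= /N2_rel weightD !innerDl inner_diag (innerC c b) !F2D1.
by do 2!case: (inner _ (alpha_last n) == 1);
  do 2!case: (weight _ == 1); case: (inner b c == 1).
Qed.
End Vectors.

(** * Connectedness *)

Lemma connected_hub (V : finZmodType) (r : rel V) h :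
  (forall b, b != 0 -> connect (edge r) b h) ->
  (forall c, c != 0 -> connect (edge r) h c) -> connected r.
Proof. by move=> to from b c b0 c0; apply: connect_trans (to b b0) (from c c0). Qed.

Section Connected.
Variable n : nat.
Hypothesis n_even : ~~ odd n.+2.
Local Notation V := 'rV['F_2]_n.+2.
Local Notation alpha i := (delta_mx 0 i : V).
Let h : V := alpha ord0.
Let g : V := h + alpha ord_max.

Let wh : weight h = 1. Proof. exact: weight_alpha. Qed.
Let wg : weight g = 0.
Proof. by rewrite weightD !weight_alpha; apply/val_inj. Qed.
Let h0 : h != 0. Proof. exact: weight1_neq0. Qed.
Let gh : inner g h = 1.
Proof. by rewrite innerDl !inner_alpha !mxE /= addr0. Qed.
Let g0 : g != 0. Proof. exact: inner1_neq0 gh. Qed.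

(** An odd vertex has edges to all nonzero even ones, and an even vertex b has
    edges to all c with (b, c) = 1. *)
Lemma N1_connected : connected (@N1_rel n.+2).
Proof.
have odd_h b : weight b = 1 -> connect (edge (@N1_rel n.+2)) b h.
  move=> wb; apply: (@connect_trans _ _ g); apply: connect1.
    by rewrite N1_edge g0 wb wg.
  by rewrite N1_edge h0 wg gh.
apply: (@connected_hub _ _ h) => [b b0|c c0].
  have [/odd_h//|] := eqVneq (weight b) 1; rewrite F2_neq1 => /eqP wb.
  have [i bi] := exists_coord1 b0.
  apply: connect_trans (odd_h _ (weight_alpha i)); apply: connect1.
  by rewrite N1_edge weight1_neq0 ?weight_alpha // wb innerC inner_alpha bi.
have [wc|wc] := eqVneq (weight c) 1; last first.
  by apply: connect1; rewrite N1_edge c0 wh wc.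
have [d wd dc] := exists_even_nonorthogonal c0 (odd_neq_ones n_even wc).
apply: (@connect_trans _ _ d); apply: connect1.
  by rewrite N1_edge (inner1_neq0 dc) wh wd.
by rewrite N1_edge c0 wd dc.
Qed.

Lemma alpha_lastE : alpha_last n.+2 = alpha ord_max.
Proof. by apply/rowP=> i; rewrite !mxE eqSS. Qed.

Let last_alpha i : inner (alpha i) (alpha_last n.+2) = (i == ord_max)%:R.
Proof. by rewrite inner_alpha alpha_lastE mxE eqxx. Qed.
Let ph : inner h (alpha_last n.+2) = 0.
Proof. by rewrite last_alpha. Qed.
Let pg : inner g (alpha_last n.+2) = 1.
Proof. by rewrite innerDl !last_alpha eqxx add0r. Qed.

Lemma N2_separating : separating (@N2_rel n.+2).
Proof.
apply: (@quad_separates _ _ h) => //; first exact: N2_quad_even.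
by move=> b; apply: N2_quad_odd.
Qed.

Lemma N1_separating : separating (@N1_rel n.+2).
Proof.
apply: (@quad_separates _ _ h) => //; first exact: N1_quad_even.
by move=> b; apply: N1_quad_odd.
Qed.

(** Every vector with last coordinate 1 has an edge to h, while g has edges to
    all nonzero vectors with last coordinate 0; odd vectors with last coordinate 1 are
    entered from a standard basis vector orthogonal to them. *)
Lemma N2_connected : connected (@N2_rel n.+2).
Proof.
have odd_g b : weight b = 1 -> inner b (alpha_last n.+2) = 0 ->
    connect (edge (@N2_rel n.+2)) b g.
  by move=> wb pb; apply: connect1; rewrite N2_edge g0 wb wg pb.
have g_last0 c : c != 0 -> inner c (alpha_last n.+2) = 0 ->
    connect (edge (@N2_rel n.+2)) g c.
  by move=> c0 pc; apply: connect1; rewrite N2_edge c0 pg pc wg.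
have odd_h b : weight b = 1 -> inner b (alpha_last n.+2) = 0 ->
    connect (edge (@N2_rel n.+2)) b h.
  by move=> wb pb; apply: connect_trans (odd_g b wb pb) (g_last0 h h0 ph).
apply: (@connected_hub _ _ h) => [b b0|c c0].
  have [pb|] := eqVneq (inner b (alpha_last n.+2)) 1.
    by apply: connect1; rewrite N2_edge h0 pb ph wh /= andbF.
  rewrite F2_neq1 => /eqP pb.
  have [wb|] := eqVneq (weight b) 1; first exact: odd_h.
  rewrite F2_neq1 => /eqP wb; have [i bi] := exists_coord1 b0.
  have i_last : i != ord_max.
    apply: contra_eq_neq pb => i_max.
    by rewrite innerC alpha_lastE inner_alpha -i_max bi.
  apply: (@connect_trans _ _ (alpha i)); last first.
    by apply: odd_h; rewrite ?weight_alpha // last_alpha (negbTE i_last).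
  apply: connect1; rewrite N2_edge weight1_neq0 ?weight_alpha // pb wb.
  by rewrite (innerC b) (inner_alpha i b) bi andbF.
have [wc|wc] := eqVneq (weight c) 1; last first.
  by apply: connect1; rewrite N2_edge c0 ph wh wc.
have [pc|] := eqVneq (inner c (alpha_last n.+2)) 1; last first.
  rewrite F2_neq1 => /eqP pc.
  by apply: connect_trans (odd_g h wh ph) (g_last0 c c0 pc).
have [j cj] := exists_coord0 (odd_neq_ones n_even wc).
have j_last : j != ord_max.
  apply: contra_eq_neq pc => j_max.
  by rewrite innerC alpha_lastE inner_alpha -j_max cj.
have pj : inner (alpha j) (alpha_last n.+2) = 0.
  by rewrite last_alpha (negbTE j_last).
apply: (@connect_trans _ _ (alpha j)).
  apply: connect_trans (odd_g h wh ph) (g_last0 _ _ pj).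
  by rewrite weight1_neq0 ?weight_alpha.
by apply: connect1; rewrite N2_edge c0 pj weight_alpha wc inner_alpha cj.
Qed.
End Connected.

Theorem theorem5p2 (k : fieldType) (char2 : 2%N \in [pchar k])
    (m n : nat) (m_gt0 : (0 < m)%N) (n_even : n = (2 * m)%N) :
  absolutely_simple (N1 char2 n) /\ absolutely_simple (N2 char2 n).
Proof.
have {m m_gt0 n_even} : ~~ odd n /\ (1 < n)%N.
  by rewrite n_even mul2n odd_double; case: m m_gt0 {n_even}.
case: n => [|[|n]] [] // n_even _; split.
- apply: (graded_absolutely_simple (@addF2vv _) (N1_graded char2 _)).
    exact: N1_separating.
  exact: N1_connected.
apply: (graded_absolutely_simple (@addF2vv _) (N2_graded char2 _)).
  exact: N2_separating.
exact: N2_connected.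
Qed.
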